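(* Let $M,N$ be two finitely presented $2$-parameter persistence modules satisfying Property (P), with finite sets of critical values $C_M$ and $C_N$. Then there exists a finite set $\Omega(C_M,C_N)$ (of switch points) ensuring that $M$ and $N$ also satisfy Property (Q), and hence Property (Q').
   Context: **Modules.** $\mathbb{R}^2$ has the partial order $u\preceq v$ iff $u_1\le v_1$ and $u_2\le v_2$. Fix a field $\mathbb{F}$. A $2$-parameter persistence module $M$ is a functor from $(\mathbb{R}^2,\preceq)$ to $\mathbb{F}$-vector spaces, with transition maps $i_M(u,v):M_u\to M_v$ for $u\preceq v$. All modules are finitely presented. **Lines.** A line $L\subset\mathbb{R}^2$ with positive slope is parameterized as $u=\vec m s+b$, $s\in\mathbb{R}$, with $m_1,m_2>0$ and the standard normalization $\max\{m_1,m_2\}=1$, $b_1+b_2=0$. The restriction $M^L$ is the $1$-parameter module $(M^L)_s=M_{\vec m s+b}$ with the induced maps. It decomposes as a finite direct sum of interval modules $I[b_j,d_j)$, $b_j<d_j\le\infty$; $\mathrm{dgm}\,M^L$ is the finite multiset of the points $(b_j,d_j)\in\mathbb{R}\times(\mathbb{R}\cup\{\infty\})$. **Bottleneck distance.** A matching between $\mathrm{dgm}\,M^L$ and $\mathrm{dgm}\,N^L$ is a multi-bijection $\sigma:P\to Q$ between multi-subsets $P\subseteq\mathrm{dgm}\,M^L$, $Q\subseteq\mathrm{dgm}\,N^L$. Its cost $c(\sigma)$ is the maximum of $\|p-\sigma(p)\|_\infty$ over $p\in P$ and of $(p_2-p_1)/2$ over the points $p=(p_1,p_2)$ of either diagram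 left unmatched, with $\infty-\infty=0$ and $\infty-a=\infty$ for $a\in\mathbb{R}$ (maximum over the empty set is $0$). $d_B$ is the minimum of $c(\sigma)$ over all matchings; a matching attaining it is optimal. **Pushes and reciprocal position.** For $u\in\mathbb{R}^2$ and $L$ of positive slope, $L$ meets the boundary of $\{v: u\preceq v\}$ in exactly one point $\mathrm{push}_L(u)$, and $p_L(u)\in\mathbb{R}$ denotes its parameter: $\mathrm{push}_L(u)=\vec m\,p_L(u)+b$. Set $A^L_u=\{1,2\}$ if $u\in L$; $A^L_u=\{1\}$ if $\mathrm{push}_L(u)=(u_1,y)$ with $y>u_2$; $A^L_u=\{2\}$ if $\mathrm{push}_L(u)=(x,u_2)$ with $x>u_1$. Let $\mathbb{P}^2=\mathbb{R}^2\cup\ell_\infty$, points at infinity being written $[0:x_1:x_2]$. For $v=[0:v_1:v_2]$ with $v_1,v_2>0$, set $A^L_v=\{1,2\}$ if $[0:m_1:m_2]=v$, $\{1\}$ if $m_2/m_1>v_2/v_1$, $\{2\}$ if $m_2/m_1<v_2/v_1$. For a set $U$ of such points, $L\sim_U L'$ iff $A^L_u=A^{L'}_u$ for all $u\in U$. **Property (P)** of $M$: there is a finite set $C_M\subset\mathbb{R}^2$ (critical values; empty iff $M$ is trivial) such that, with $\overline{C}_M$ its closure under least upper bounds, for all $u\preceq v$: $\mathrm{rank}\,i_M(u,v)=\mathrm{rank}\,i_M(\bar u,\bar v)$ where $\bar u=\max\{u'\in\overline{C}_M: u'\preceq u\}$ and $\bar v=\max\{v'\in\overline{C}_M:v'\preceq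 v\}$, if $\{u'\in\overline{C}_M:u'\preceq u\}\ne\emptyset$, and $\mathrm{rank}\,i_M(u,v)=0$ otherwise. **The bijection $\Gamma_{L,L'}$.** It is known that if $L\sim_{\overline{C}_M}L'$ then there is a multi-bijection $\gamma_M:\mathrm{dgm}\,M^L\to\mathrm{dgm}\,M^{L'}$ sending $(p_L(u),p_L(v))$ to $(p_{L'}(u),p_{L'}(v))$ and $(p_L(u),\infty)$ to $(p_{L'}(u),\infty)$ for $u,v\in\overline{C}_M$ (all points of the diagrams are of this form); similarly $\gamma_N$. If $L\sim_{\overline{C}_M\cup\overline{C}_N}L'$, for a matching $\sigma$ between $\mathrm{dgm}\,M^L$ and $\mathrm{dgm}\,N^L$ put $\Gamma_{L,L'}(\sigma)=\gamma_N\circ\sigma\circ\gamma_M^{-1}$, a matching between $\mathrm{dgm}\,M^{L'}$ and $\mathrm{dgm}\,N^{L'}$. **Property (Q)** of $M,N$ (with given $C_M,C_N$): there is a finite set $\Omega=\Omega(C_M,C_N)\subset\mathbb{P}^2$, whose points at infinity are of the form $[0:v_1:v_2]$ with $v_1,v_2>0$, such that for all $u,v,w,x\in\overline{C}_M\cup\overline{C}_N$ and $\delta,\eta\in\{1,2\}$ (not necessarily distinct), the sign (positive, negative or zero) of $\frac{|p_L(u)-p_L(v)|}{\delta}-\frac{|p_L(w)-p_L(x)|}{\eta}$ is the same for all lines $L$ of positive slope in the same $\sim_{\overline{C}_M\cup\overline{C}_N\cup\Omega}$-equivalence class. **Property (Q')** of $M,N$ (with given $C_M,C_N$): there is a finite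 set $\Omega\subset\mathbb{P}^2$ (same convention on points at infinity) such that the following holds. Let $L$ be any line with positive slope and $\sigma$ an optimal matching between $\mathrm{dgm}\,M^L$ and $\mathrm{dgm}\,N^L$ whose cost is realised by the pushes onto $L$ of some $u,v\in\overline{C}_M\cup\overline{C}_N$, i.e. $c(\sigma)=|p_L(u)-p_L(v)|/\delta$ with $\delta\in\{1,2\}$. Then for every $L'\sim_{\overline{C}_M\cup\overline{C}_N\cup\Omega}L$, $\Gamma_{L,L'}(\sigma)$ is an optimal matching between $\mathrm{dgm}\,M^{L'}$ and $\mathrm{dgm}\,N^{L'}$, and its cost is realised by the pushes of $u,v$ onto $L'$: $c(\sigma)=\frac{|p_L(u)-p_L(v)|}{\delta}\iff c(\Gamma_{L,L'}(\sigma))=\frac{|p_{L'}(u)-p_{L'}(v)|}{\delta}$. *)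

(* Defs.v *)
From HB Require Import structures.
From mathcomp Require Import all_boot all_order all_algebra.
From mathcomp Require Import all_classical all_reals.
From mathcomp Require Import ereal topology normedtype.

Set Implicit Arguments.
Unset Strict Implicit.
Unset Printing Implicit Defensive.

Import Order.TTheory GRing.Theory Num.Theory.
Import numFieldNormedType.Exports.

Local Open Scope classical_set_scope.
Local Open Scope ring_scope.

(* Finitely presented modules are pointwise finite dimensional, so the values
   are taken in [vectType F].  The maps [pmap u v] are given for all [u], [v],
   but only those with [u <= v] are meaningful (and ever used). *)
Record pmodule (F : fieldType) (d : Order.disp_t) (I : porderType d) := PModule {
  pobj :> I -> vectType F;
  pmap : forall u v : I, 'Hom(pobj u, pobj v);
  pmap_id : forall u, pmap u u = \1%VF;
  pmap_comp : forall u v w, (u <= v)%O -> (v <= w)%O ->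
    pmap u w = (pmap v w \o pmap u v)%VF }.

Section Modules.
Context (F : fieldType) (d : Order.disp_t) (I : porderType d).
Implicit Types M N : pmodule F I.

Definition prank M (u v : I) : nat := \dim (limg (pmap M u v)).

Definition trivial_module M := forall (u : I) (y : M u), y = 0.

(* M is the cokernel of a morphism from the free module on generators of grades
   [b j] to the free module on generators of grades [a i], with matrix [c]:
   the images of the latter generators are the [x i]. *)
Definition finitely_presented M :=
  exists (n : nat) (a : 'I_n -> I) (x : forall i, M (a i))
         (m : nat) (b : 'I_m -> I) (c : 'I_m -> 'I_n -> F),
    (forall j i, c j i != 0 -> (a i <= b j)%O) /\
    forall u : I,
      (forall y : M u, exists k : 'I_n -> F,
         y = \sum_(i | (a i <= u)%O) k i *: pmap M (a i) u (x i)) /\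
      (forall k : 'I_n -> F,
         \sum_(i | (a i <= u)%O) k i *: pmap M (a i) u (x i) = 0 <->
         exists l : 'I_m -> F, forall i, (a i <= u)%O ->
           k i = \sum_(j | (b j <= u)%O) l j * c j i).

Definition piso M N :=
  exists f : forall u, 'Hom(M u, N u),
    (forall u, bijective (f u)) /\
    (forall u v, (u <= v)%O ->
      (f v \o pmap M u v)%VF = (pmap N u v \o f u)%VF).

Fact zero_module_comp (u v w : I) : (u <= v)%O -> (v <= w)%O ->
  \1%VF = (\1 \o \1)%VF :> 'End('rV[F]_0).
Proof. by move=> _ _; rewrite comp_lfun1l. Qed.

Definition zero_module : pmodule F I :=
  @PModule F d I (fun=> 'rV[F]_0) (fun _ _ => \1%VF) (fun=> erefl)
    zero_module_comp.

Section DirectSum.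
Context (M N : pmodule F I).

Definition dsum_fun (u v : I) (x : M u * N u) : M v * N v :=
  (pmap M u v x.1, pmap N u v x.2).

Fact dsum_fun_linear u v : linear (@dsum_fun u v).
Proof. by move=> a x y; rewrite /dsum_fun /= !linearP. Qed.

HB.instance Definition _ u v :=
  GRing.isLinear.Build F (M u * N u)%type (M v * N v)%type *:%R
    (@dsum_fun u v) (@dsum_fun_linear u v).

Definition dsum_map u v : 'Hom((M u * N u)%type, (M v * N v)%type) :=
  linfun (@dsum_fun u v).

Fact dsum_id u : dsum_map u u = \1%VF.
Proof.
by apply/lfunP => -[x y]; rewrite !lfunE /= /dsum_fun !pmap_id !id_lfunE.
Qed.

Fact dsum_comp u v w : (u <= v)%O -> (v <= w)%O ->
  dsum_map u w = (dsum_map v w \o dsum_map u v)%VF.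
Proof.
move=> uv vw; apply/lfunP => -[x y]; rewrite comp_lfunE !lfunE /= /dsum_fun /=.
by rewrite !(pmap_comp _ uv vw) !comp_lfunE.
Qed.

Definition dsum : pmodule F I :=
  @PModule F d I (fun u => (M u * N u)%type : vectType F) dsum_map
    dsum_id dsum_comp.

End DirectSum.
End Modules.

Section Intervals.
Context (F : fieldType) (R : realType).

Definition in_bar (p : R * \bar R) (s : R) : bool :=
  (p.1 <= s) && (s%:E < p.2)%E.

(* The value of I[b,d) at s is 'rV_1 if b <= s < d and 'rV_0 otherwise; the
   1 x 1 matrix [const_mx 1] is the identity. *)
Definition interval_map (p : R * \bar R) (s t : R) :
    'Hom('rV[F]_(in_bar p s), 'rV[F]_(in_bar p t)) :=
  linfun (mulmxr (const_mx 1 : 'M[F]_(in_bar p s, in_bar p t))).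

Fact interval_id p s : interval_map p s s = \1%VF.
Proof.
apply/lfunP => x; rewrite !lfunE /=; case: (in_bar p s) x => x.
  by apply/rowP => i; rewrite mxE big_ord1 !mxE mulr1 !ord1.
by apply/rowP => -[].
Qed.

Fact interval_comp p (s t r : R) : (s <= t)%O -> (t <= r)%O ->
  interval_map p s r = (interval_map p t r \o interval_map p s t)%VF.
Proof.
move=> st tr; apply/lfunP => x; rewrite comp_lfunE !lfunE /= -mulmxA.
congr (_ *m _).
suff : in_bar p s -> in_bar p r -> in_bar p t.
  case: (in_bar p s) (in_bar p r) (in_bar p t) => -[] -[] H;
    apply/matrixP => i j; rewrite !mxE; by [
    rewrite big_ord1 !mxE mulr1 | case: i | case: j | have := H isT isT].
rewrite /in_bar => /andP[ps _] /andP[_ rp].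
by rewrite (le_trans ps st) (le_lt_trans _ rp).
Qed.

Definition interval_module (p : R * \bar R) : pmodule F R :=
  @PModule F _ R (fun s => 'rV[F]_(in_bar p s)) (interval_map p)
    (interval_id p) (@interval_comp p).

Definition interval_sum (D : seq (R * \bar R)) : pmodule F R :=
  foldr (fun p V => dsum (interval_module p) V) (zero_module F R) D.

(* The multiset dgm V, as a list (its order is irrelevant). *)
Definition is_dgm (V : pmodule F R) (D : seq (R * \bar R)) : Prop :=
  (forall p, p \in D -> (p.1%:E < p.2)%E) /\ piso V (interval_sum D).

End Intervals.

Section Matchings.
Context (R : realType).
Implicit Types (p q : R * \bar R) (D E : seq (R * \bar R)).

(* oo - oo = 0 *)
Definition ereal_dist (x y : \bar R) : \bar R :=
  if x == y then 0%E else `|x - y|%E.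

Definition linf_dist p q : \bar R :=
  maxe (ereal_dist p.1%:E q.1%:E) (ereal_dist p.2 q.2).

Definition dgm_pt D (i : 'I_(size D)) : R * \bar R := tnth (in_tuple D) i.

(* A multi-bijection between multi-subsets of D and E, given by its graph on
   the positions of D and E (so that equal points are told apart). *)
Definition is_matching D E (sigma : {set 'I_(size D) * 'I_(size E)}) : bool :=
  [forall x in sigma, forall y in sigma,
     ((x.1 == y.1) ==> (x == y)) && ((x.2 == y.2) ==> (x == y))].

Definition half_persistence p : \bar R := ((p.2 - p.1%:E) * (2^-1)%:E)%E.

Definition cost D E (sigma : {set 'I_(size D) * 'I_(size E)}) : \bar R :=
  maxe (\big[maxe/0%E]_(x in sigma) linf_dist (dgm_pt x.1) (dgm_pt x.2))
  (maxe (\big[maxe/0%E]_(i | i \notin (fst @: sigma)%SET)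
           half_persistence (dgm_pt i))
        (\big[maxe/0%E]_(j | j \notin (snd @: sigma)%SET)
           half_persistence (dgm_pt j))).

Definition bottleneck D E : \bar R :=
  \big[mine/+oo%E]_(sigma : {set 'I_(size D) * 'I_(size E)} |
     is_matching sigma) cost sigma.

Definition is_optimal D E (sigma : {set 'I_(size D) * 'I_(size E)}) : Prop :=
  is_matching sigma /\ cost sigma = bottleneck D E.

End Matchings.

Section Lines.
Context (R : realType).

Record line := Line {
  ldir : R * R;
  lbase : R * R;
  ldir1_gt0 : 0 < ldir.1;
  ldir2_gt0 : 0 < ldir.2;
  ldir_max : Num.max ldir.1 ldir.2 = 1;
  lbase_sum : lbase.1 + lbase.2 = 0 }.

Implicit Types (L : line) (u v : R *p R).

Definition line_pt L (s : R) : R *p R :=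
  ((ldir L).1 * s + (lbase L).1, (ldir L).2 * s + (lbase L).2).

Lemma line_pt_le L (s t : R) : s <= t -> (line_pt L s <= line_pt L t)%O.
Proof.
move=> st; rewrite Order.ProdOrder.leEprod /=.
by rewrite !lerD2r !ler_pM2l ?st ?ldir1_gt0 ?ldir2_gt0.
Qed.

Definition upset u : set (R * R) := [set v : R * R | (u <= (v : R *p R))%O].

Definition boundary (A : set (R * R)) : set (R * R) := closure A `\` interior A.

Lemma boundary_upset u (v : R * R) : boundary (upset u) v <->
  u.1 <= v.1 /\ u.2 <= v.2 /\ (v.1 = u.1 \/ v.2 = u.2).
Proof.
have upE : upset u = [set` `[u.1, +oo[] `*` [set` `[u.2, +oo[].
  apply/seteqP; split => w; rewrite /upset /= !in_itv /= !andbT.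
    by rewrite Order.ProdOrder.leEprod => /andP[].
  by case=> h1 h2; rewrite Order.ProdOrder.leEprod h1.
have up_closed : closed (upset u).
  have -> : upset u = (fst @^-1` [set x | u.1 <= x] : set (R * R)) `&`
                      (snd @^-1` [set x | u.2 <= x] : set (R * R)).
    apply/seteqP; split => w; rewrite /upset /=.
      by rewrite Order.ProdOrder.leEprod => /andP[].
    by case=> h1 h2; rewrite Order.ProdOrder.leEprod h1.
  apply: closedI; apply: preimage_closed; try exact: closed_ge.
    by move=> w _; exact: cvg_fst.
  by move=> w _; exact: cvg_snd.
have intE : interior (upset u) v <-> u.1 < v.1 /\ u.2 < v.2.
  rewrite upE; split=> [[[P Q] [/= nP nQ] PQ]|[h1 h2]].
    split.
      suff : [set` `[u.1, +oo[]° v.1.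
        by rewrite interior_itv_bndy /= in_itv /= andbT.
      apply: filterS nP => x Px.
      by have [] := PQ (x, v.2) (conj Px (nbhs_singleton nQ)).
    suff : [set` `[u.2, +oo[]° v.2.
      by rewrite interior_itv_bndy /= in_itv /= andbT.
    apply: filterS nQ => x Qx.
    by have [] := PQ (v.1, x) (conj (nbhs_singleton nP) Qx).
  exists ([set` `[u.1, +oo[], [set` `[u.2, +oo[]) => //=; split.
    suff : [set` `[u.1, +oo[]° v.1 by [].
    by rewrite interior_itv_bndy /= in_itv /= andbT.
  suff : [set` `[u.2, +oo[]° v.2 by [].
  by rewrite interior_itv_bndy /= in_itv /= andbT.
rewrite /boundary -(closure_id _).1 //.
split=> [[]|[h1 [h2 h]]].
  rewrite /= {1}/upset /= Order.ProdOrder.leEprod => /andP[h1 h2] /intE h.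
  split=> //; split=> //; move: h1 h2; rewrite !le_eqVlt.
  move=> /orP[/eqP ->|h1]; first by left.
  move=> /orP[/eqP ->|h2]; first by right.
  by case: h.
split; first by rewrite /upset /= Order.ProdOrder.leEprod h1.
by move=> /intE [k1 k2]; case: h => e; [move: k1 | move: k2]; rewrite e ltxx.
Qed.

Lemma push_paramP L u s : boundary (upset u) (line_pt L s) <->
  s = Num.max ((u.1 - (lbase L).1) / (ldir L).1)
              ((u.2 - (lbase L).2) / (ldir L).2).
Proof.
have m1 := ldir1_gt0 L; have m2 := ldir2_gt0 L.
have le1 : (u.1 <= (line_pt L s).1) = ((u.1 - (lbase L).1) / (ldir L).1 <= s).
  by rewrite /= ler_pdivrMr // lerBlDr mulrC.
have le2 : (u.2 <= (line_pt L s).2) = ((u.2 - (lbase L).2) / (ldir L).2 <= s).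
  by rewrite /= ler_pdivrMr // lerBlDr mulrC.
have eq1 : (line_pt L s).1 = u.1 <-> s = (u.1 - (lbase L).1) / (ldir L).1.
  split=> [<-|->] /=; first by rewrite addrK mulrC mulKf ?gt_eqF.
  by rewrite mulrC divfK ?gt_eqF // subrK.
have eq2 : (line_pt L s).2 = u.2 <-> s = (u.2 - (lbase L).2) / (ldir L).2.
  split=> [<-|->] /=; first by rewrite addrK mulrC mulKf ?gt_eqF.
  by rewrite mulrC divfK ?gt_eqF // subrK.
rewrite boundary_upset le1 le2 eq1 eq2.
set x := _ / _; set y := _ / _; split=> [[hx [hy h]]|->].
  by apply/eqP; rewrite eq_le ge_max hx hy andbT le_max; case: h => ->;
    rewrite lexx ?orbT.
rewrite !le_max !lexx orbT; split=> //; split=> //.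
by case: (leP x y); [right | left].
Qed.

(* p_L(u) *)
Definition push_param L u : R :=
  xget 0 [set s | boundary (upset u) (line_pt L s)].

Lemma push_paramE L u : push_param L u =
  Num.max ((u.1 - (lbase L).1) / (ldir L).1)
          ((u.2 - (lbase L).2) / (ldir L).2).
Proof.
by apply: xget_unique => [|s /=]; rewrite ?push_paramP //; apply/push_paramP.
Qed.

Definition push L u : R *p R := line_pt L (push_param L u).

(* The points of the projective plane: affine points, and points at infinity
   [0:x1:x2] given by homogeneous coordinates. *)
Inductive ppoint := Aff of R *p R | Inf of R * R.

(* The elements 1 and 2 of the index set are ord0 and ord_max in 'I_2. *)
Definition position L (q : ppoint) : {set 'I_2} :=
  match q with
  | Aff u =>
      if `[< exists s, line_pt L s = u >] then [set: 'I_2]%SET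
      else if ((push L u).1 == u.1) && (u.2 < (push L u).2) then [set ord0]%SET
      else if ((push L u).2 == u.2) && (u.1 < (push L u).1)
        then [set ord_max]%SET
      else finset.set0
  | Inf v =>
      if (ldir L).1 * v.2 == (ldir L).2 * v.1 then [set: 'I_2]%SET
      else if v.2 / v.1 < (ldir L).2 / (ldir L).1 then [set ord0]%SET
      else if (ldir L).2 / (ldir L).1 < v.2 / v.1 then [set ord_max]%SET
      else finset.set0
  end.

Definition line_equiv (U : set ppoint) L L' :=
  forall q, U q -> position L q = position L' q.

End Lines.

Section Properties.
Context (R : realType) (F : fieldType).
Implicit Types (M N : pmodule F (R *p R)) (C : set (R *p R)).

Section Restriction.
Context (M : pmodule F (R *p R)) (L : line R).

Fact restrict_comp (s t r : R) : (s <= t)%O -> (t <= r)%O ->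
  pmap M (line_pt L s) (line_pt L r) =
  (pmap M (line_pt L t) (line_pt L r) \o pmap M (line_pt L s) (line_pt L t))%VF.
Proof. by move=> st tr; apply: pmap_comp; apply: line_pt_le. Qed.

Definition restrict : pmodule F R :=
  @PModule F _ R (fun s => M (line_pt L s))
    (fun s t => pmap M (line_pt L s) (line_pt L t))
    (fun s => pmap_id M (line_pt L s)) restrict_comp.

End Restriction.

Definition lub_closure C : set (R *p R) :=
  smallest [set A | forall u v, A u -> A v -> A (u `|` v)%O] C.

Definition is_max (A : set (R *p R)) u := A u /\ ubound A u.

Definition below C u : set (R *p R) := [set w | lub_closure C w /\ (w <= u)%O].

Lemma lub_closure_finite C : finite_set C -> finite_set (lub_closure C).
Proof.
move=> finC; apply: (@sub_finite_set _ _ ((fst @` C) `*` (snd @` C))).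
  apply: smallest_sub => [u v [u1 u2] [v1 v2]|u Cu /=]; last first.
    by split; exists u.
  rewrite Order.ProdOrder.joinEprod; split; rewrite /= joinEtotal.
    by case: (leP u.1 v.1) => _; [exact: v1 | exact: u1].
  by case: (leP u.2 v.2) => _; [exact: v2 | exact: u2].
by apply: finite_setX; apply: finite_image.
Qed.

Lemma below_max C u : finite_set C -> below C u !=set0 ->
  exists u', is_max (below C u) u'.
Proof.
move=> finC [w0 Bw0].
have /finite_seqP[s sE] : finite_set (below C u).
  by apply: sub_finite_set (lub_closure_finite finC) => w [].
have joinB w w' : below C u w -> below C u w' -> below C u (w `|` w')%O.
  move=> [Cw wu] [Cw' w'u]; split; last by rewrite leUx wu.
  rewrite /lub_closure => A AC; have [/= joinA _] := AC.
  by apply: joinA; [apply: Cw | apply: Cw'].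
have sB w : w \in s -> below C u w by rewrite sE.
exists (foldr (fun w w' => w `|` w')%O w0 s); split.
  elim: s {sE} sB => //= w s IH sB; apply: joinB; first by apply/sB/mem_head.
  by apply: IH => w' w's; apply: sB; rewrite inE w's orbT.
move=> w; rewrite sE /= => {sE sB}.
elim: s => //= w' s IH; rewrite inE => /orP[/eqP ->|/IH ws]; first exact: leUl.
exact: le_trans ws (leUr _ _).
Qed.

Definition property_P M C :=
  [/\ finite_set C,
      C = set0 <-> trivial_module M
    & forall u v, (u <= v)%O ->
      (below C u !=set0 -> forall u' v', is_max (below C u) u' ->
         is_max (below C v) v' -> prank M u v = prank M u' v') /\
      (below C u = set0 -> prank M u v = 0%N)].

(* gamma is the multi-bijection from D = dgm M^L to D' = dgm M^L'. *)
Definition is_gamma C (L L' : line R) (D D' : seq (R * \bar R))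
    (gamma : 'I_(size D) -> 'I_(size D')) :=
  bijective gamma /\
  forall i,
    (forall u v, lub_closure C u -> lub_closure C v ->
       dgm_pt i = (push_param L u, (push_param L v)%:E) ->
       dgm_pt (gamma i) = (push_param L' u, (push_param L' v)%:E)) /\
    (forall u, lub_closure C u ->
       dgm_pt i = (push_param L u, +oo%E) ->
       dgm_pt (gamma i) = (push_param L' u, +oo%E)).

(* The graph of gammaN \o sigma \o gammaM^-1. *)
Definition Gamma (DM DN DM' DN' : seq (R * \bar R))
    (gammaM : 'I_(size DM) -> 'I_(size DM'))
    (gammaN : 'I_(size DN) -> 'I_(size DN'))
    (sigma : {set 'I_(size DM) * 'I_(size DN)}) :
    {set 'I_(size DM') * 'I_(size DN')} :=
  ((fun x => (gammaM x.1, gammaN x.2)) @: sigma)%SET.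

Definition switch_set (Omega : set (ppoint R)) :=
  finite_set Omega /\ forall v, Omega (Inf v) -> 0 < v.1 /\ 0 < v.2.

Definition critical_points CM CN : set (R *p R) :=
  lub_closure CM `|` lub_closure CN.

Definition property_Q CM CN (Omega : set (ppoint R)) :=
  forall u v w x, critical_points CM CN u -> critical_points CM CN v ->
    critical_points CM CN w -> critical_points CM CN x ->
  forall delta eta : nat, delta \in [:: 1; 2]%N -> eta \in [:: 1; 2]%N ->
  forall L L', line_equiv (@Aff R @` critical_points CM CN `|` Omega) L L' ->
  Num.sg (`|push_param L u - push_param L v| / delta%:R
          - `|push_param L w - push_param L x| / eta%:R) =
  Num.sg (`|push_param L' u - push_param L' v| / delta%:R
          - `|push_param L' w - push_param L' x| / eta%:R).

(* The first two clauses of the conclusion say that gamma_M and gamma_N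
   exist, so that Gamma_{L,L'} is defined.  They are unique only up to
   permuting equal points of a diagram, so the rest is asserted for all choices. *)
Definition property_Q' M N CM CN (Omega : set (ppoint R)) :=
  forall (L : line R) (DM DN : seq (R * \bar R)),
    is_dgm (restrict M L) DM -> is_dgm (restrict N L) DN ->
  forall (sigma : {set 'I_(size DM) * 'I_(size DN)}) u v (delta : nat),
    critical_points CM CN u -> critical_points CM CN v ->
    delta \in [:: 1; 2]%N -> is_optimal sigma ->
    cost sigma = (`|push_param L u - push_param L v| / delta%:R)%:E ->
  forall (L' : line R) (DM' DN' : seq (R * \bar R)),
    line_equiv (@Aff R @` critical_points CM CN `|` Omega) L L' ->
    is_dgm (restrict M L') DM' -> is_dgm (restrict N L') DN' ->
  (exists gammaM : 'I_(size DM) -> 'I_(size DM'), is_gamma CM L L' gammaM) /\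
  (exists gammaN : 'I_(size DN) -> 'I_(size DN'), is_gamma CN L L' gammaN) /\
  forall (gammaM : 'I_(size DM) -> 'I_(size DM'))
         (gammaN : 'I_(size DN) -> 'I_(size DN')),
    is_gamma CM L L' gammaM -> is_gamma CN L L' gammaN ->
    is_optimal (Gamma gammaM gammaN sigma) /\
    (cost sigma = (`|push_param L u - push_param L v| / delta%:R)%:E <->
     cost (Gamma gammaM gammaN sigma) =
       (`|push_param L' u - push_param L' v| / delta%:R)%:E).

End Properties.

(* Main.v *)
Require Import Defs.
From HB Require Import structures.
From mathcomp Require Import all_boot all_order all_algebra.
From mathcomp Require Import all_classical all_reals.
From mathcomp Require Import zify ring lra.

(* As long as the reciprocal position of L to u and v is fixed, p_L(u) - p_L(v)
   is a difference (A - k b_1) / m_1 - (B - k b_2) / m_2 with A, B and k fixed,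
   and so is any linear combination of such differences, in particular the
   quantity of Property (Q).  Its sign is the position of L relative to a single
   point of the projective plane, namely (A / k, B / k) if k <> 0 and
   [0 : |A| : |B|] otherwise.  Omega consists of these points.

   For (Q'), Property (P) and the uniqueness of barcodes, in the form of an
   inclusion-exclusion formula for multiplicities in terms of ranks, give the
   bijections gamma.  All the quantities that enter the cost of a matching have
   the form |p_L(u) - p_L(v)| / delta (or are infinite), and by (Q) they compare
   in the same way on L and on L'. *)

Set Implicit Arguments.
Unset Strict Implicit.
Unset Printing Implicit Defensive.

Import Order.TTheory GRing.Theory Num.Theory.
Local Open Scope classical_set_scope.
Local Open Scope ring_scope.
Local Arguments position : simpl never.

(** * Pushes, reciprocal position and the construction of the switch points *)

Section SwitchPoints.
Context (R : realType).
Implicit Types (L : line R) (u v : R *p R) (t : R * R * R).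

Definition push1 L (a : R) : R := (a - (lbase L).1) / (ldir L).1.
Definition push2 L (a : R) : R := (a - (lbase L).2) / (ldir L).2.

Lemma push_param_max L u :
  push_param L u = Num.max (push1 L u.1) (push2 L u.2).
Proof. exact: push_paramE. Qed.

Lemma le_push1 L a s : (push1 L a <= s) = (a <= (ldir L).1 * s + (lbase L).1).
Proof. by rewrite /push1 ler_pdivrMr ?ldir1_gt0 // lerBlDr mulrC. Qed.

Lemma le_push2 L a s : (push2 L a <= s) = (a <= (ldir L).2 * s + (lbase L).2).
Proof. by rewrite /push2 ler_pdivrMr ?ldir2_gt0 // lerBlDr mulrC. Qed.

Lemma ge_push1 L a s : (s <= push1 L a) = ((ldir L).1 * s + (lbase L).1 <= a).
Proof. by rewrite /push1 ler_pdivlMr ?ldir1_gt0 // lerBrDr mulrC. Qed.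

Lemma ge_push2 L a s : (s <= push2 L a) = ((ldir L).2 * s + (lbase L).2 <= a).
Proof. by rewrite /push2 ler_pdivlMr ?ldir2_gt0 // lerBrDr mulrC. Qed.

(** The push is the first parameter at which [L] enters the upset of [u]. This turns the sets of
    critical values below a point of [L], on which (P) depends, into conditions on pushes. *)
Lemma le_line_pt L u s : (u <= line_pt L s)%O = (push_param L u <= s).
Proof.
by rewrite push_param_max ge_max le_push1 le_push2 Order.ProdOrder.leEprod.
Qed.

(** Two weak inequalities encode the position, so equal positions amount to equal signs of
    [push1 L u.1 - push2 L u.2]. *)
Lemma mem_position_Aff L u :
  (ord0 \in position L (Aff u) = (push2 L u.2 <= push1 L u.1)) *
  (ord_max \in position L (Aff u) = (push1 L u.1 <= push2 L u.2)).
Proof.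
rewrite /position.
(* The point lies on [L] exactly when [L] reaches both of its coordinates at the same parameter. *)
have -> : `[< exists s, line_pt L s = u >] = (push1 L u.1 == push2 L u.2).
  apply/asboolP/eqP => [[s <-]|e].
    apply/eqP; rewrite eq_le le_push1 ge_push1 /=.
    have -> : push2 L ((ldir L).2 * s + (lbase L).2) = s.
      by apply/eqP; rewrite eq_le le_push2 ge_push2 /= lexx.
    by rewrite lexx.
  exists (push1 L u.1); rewrite [u]surjective_pairing /line_pt /=; congr pair.
    by apply/eqP; rewrite eq_le -le_push1 -ge_push1 /= lexx.
  by apply/eqP; rewrite e eq_le -le_push2 -ge_push2 /= lexx.
have E1 : ((push L u).1 == u.1) = (push_param L u == push1 L u.1).
  by rewrite eq_le -ge_push1 -le_push1 -eq_le eq_sym eq_sym.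
have E2 : ((push L u).2 == u.2) = (push_param L u == push2 L u.2).
  by rewrite eq_le -ge_push2 -le_push2 -eq_le.
have E3 : (u.1 < (push L u).1) = (push1 L u.1 < push_param L u).
  by rewrite ltNge -ge_push1 -ltNge.
have E4 : (u.2 < (push L u).2) = (push2 L u.2 < push_param L u).
  by rewrite ltNge -ge_push2 -ltNge.
rewrite E1 E2 E3 E4 push_param_max.
by case: (ltgtP (push1 L u.1) (push2 L u.2)) => c;
  rewrite ?eqxx ?c ?ltxx ?(lt_eqF c) ?(gt_eqF c) /= !inE.
Qed.

Lemma mem_position_Inf L (v : R * R) : 0 < v.1 -> 0 < v.2 ->
  (ord0 \in position L (Inf v) = (v.2 / (ldir L).2 <= v.1 / (ldir L).1)) *
  (ord_max \in position L (Inf v) = (v.1 / (ldir L).1 <= v.2 / (ldir L).2)).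
Proof.
move=> v1 v2; have m1 := ldir1_gt0 L; have m2 := ldir2_gt0 L.
have F a b c d : 0 < b -> 0 < d -> (a / b < c / d :> R) = (a * d < c * b).
  by move=> b0 d0; rewrite ltr_pdivrMr // mulrAC ltr_pdivlMr.
rewrite /position !leNgt !F // !(mulrC v.1) !(mulrC v.2).
by case: ltgtP => c; rewrite !inE.
Qed.

(* The functions [(A - k b_1) / m_1 - (B - k b_2) / m_2] of the line with
   direction [m] and base point [b], where [t = (A, B, k)]. *)
Definition lform t L : R :=
  (t.1.1 - t.2 * (lbase L).1) / (ldir L).1 -
  (t.1.2 - t.2 * (lbase L).2) / (ldir L).2.

(* If [k = 0] and [A], [B] do not have the same strict sign, the sign of
   [A / m_1 - B / m_2] is the same for all lines and any point will do. *)
Definition switch_point t : ppoint R :=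
  if t.2 != 0 then Aff (t.1.1 / t.2, t.1.2 / t.2)
  else if 0 < t.1.1 * t.1.2 then Inf (`|t.1.1|, `|t.1.2|) else Aff (0, 0).

Lemma eq_sg (x y : R) : (x <= 0) = (y <= 0) -> (0 <= x) = (0 <= y) ->
  Num.sg x = Num.sg y.
Proof. by case: (sgrP x) => ?; case: (sgrP y) => // ?; lra. Qed.

Lemma eq_sg_sub_le (x y z w : R) : Num.sg (x - y) = Num.sg (z - w) ->
  (x <= y) = (z <= w).
Proof. by move=> e; rewrite -subr_le0 -sgr_le0 e sgr_le0 subr_le0. Qed.

(** In each case of [switch_point] the form is a constant times a difference whose sign the position
    records, or else has the same sign on all lines. *)
Lemma lform_sg t L L' :
  position L (switch_point t) = position L' (switch_point t) ->
  Num.sg (lform t L) = Num.sg (lform t L').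
Proof.
case: t => -[A B] k; rewrite /switch_point /lform /=.
have [->|k0] /= := eqVneq k 0; last first.
  have E l : (A - k * (lbase l).1) / (ldir l).1 -
      (B - k * (lbase l).2) / (ldir l).2 =
      k * (push1 l (A / k) - push2 l (B / k)).
    have := ldir1_gt0 l; have := ldir2_gt0 l; rewrite /push1 /push2.
    move=> m2 m1; field; rewrite k0 !gt_eqF //.
  move=> e; rewrite !E !sgrM; congr (_ * _).
  have [p0 p1] := mem_position_Aff L (A / k, B / k).
  have [q0 q1] := mem_position_Aff L' (A / k, B / k).
  by apply: eq_sg; rewrite ?subr_le0 ?subr_ge0; rewrite -?p0 -?p1 -?q0 -?q1 e.
have im1 (l : line R) : 0 < (ldir l).1^-1 by rewrite invr_gt0 ldir1_gt0.
have im2 (l : line R) : 0 < (ldir l).2^-1 by rewrite invr_gt0 ldir2_gt0.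
case: ifP => [AB|AB _].
  have A0 : 0 < `|A|.
    by rewrite normr_gt0; apply: contraTneq AB => ->; rewrite mul0r ltxx.
  have B0 : 0 < `|B|.
    by rewrite normr_gt0; apply: contraTneq AB => ->; rewrite mulr0 ltxx.
  have E l : (A - 0 * (lbase l).1) / (ldir l).1 -
      (B - 0 * (lbase l).2) / (ldir l).2 =
      Num.sg A * (`|A| / (ldir l).1 - `|B| / (ldir l).2).
    rewrite !mul0r !subr0 mulrBr !mulrA -numEsg.
    by rewrite [in RHS](_ : Num.sg A = Num.sg B) -?numEsg //;
      case: (sgrP A) AB => ?; case: (sgrP B) => //; nra.
  move=> e; rewrite !E !sgrM; congr (_ * _).
  have [p0 p1] := @mem_position_Inf L (`|A|, `|B|) A0 B0.
  have [q0 q1] := @mem_position_Inf L' (`|A|, `|B|) A0 B0.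
  by apply: eq_sg; rewrite ?subr_le0 ?subr_ge0; rewrite -?p0 -?p1 -?q0 -?q1 e.
(* Here [A * B <= 0], so [A / m_1] and [- B / m_2] never have opposite strict signs, and positive
   denominators cannot change the sign of their sum. *)
rewrite !mul0r !subr0.
move: (im1 L) (im2 L) (im1 L') (im2 L').
move: (_ L).1^-1 (_ L).2^-1 (_ L').1^-1 (_ L').2^-1 => x y z w x0 y0 z0 w0.
have [A0|A0|A0] := ltgtP A 0; have [B0|B0|B0] := ltgtP B 0; 
  rewrite ?A0 ?B0 ?mul0r ?subr0 ?sub0r ?sgrN ?sgrM ?sgr0 ?oppr0 ?(gtr0_sg x0)
    ?(gtr0_sg y0) ?(gtr0_sg z0) ?(gtr0_sg w0) //; try nra.
  by rewrite !ltr0_sg //; nra.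
by rewrite !gtr0_sg //; nra.
Qed.

(** The four possible forms of p_L(u) - p_L(v): each push is determined by the first or by the
    second coordinate. In order: both first, both second, first for [u] only, first for [v] only. *)
Definition push_forms u v : seq (R * R * R) :=
  [:: (u.1 - v.1, 0, 0); (0, v.2 - u.2, 0); (u.1, v.2, 1); (- v.1, - u.2, - 1)].

Lemma push_param_position L L' u : position L (Aff u) = position L' (Aff u) ->
  (push_param L u = push1 L u.1 /\ push_param L' u = push1 L' u.1) \/
  (push_param L u = push2 L u.2 /\ push_param L' u = push2 L' u.2).
Proof.
move=> e; rewrite !push_param_max.
have [p _] := mem_position_Aff L u; have [p' _] := mem_position_Aff L' u.
case: (leP (push2 L u.2) (push1 L u.1)) p => c p.
  by left; rewrite !max_l // -p' -e p.
right; rewrite !max_r ?(ltW c) //; apply: ltW.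
by rewrite ltNge -p' -e p.
Qed.

Lemma push_param_sub L L' u v :
  position L (Aff u) = position L' (Aff u) ->
  position L (Aff v) = position L' (Aff v) ->
  exists2 t, t \in push_forms u v &
    push_param L u - push_param L v = lform t L /\
    push_param L' u - push_param L' v = lform t L'.
Proof.
have E t l : lform t l = t.1.1 / (ldir l).1 - t.1.2 / (ldir l).2 -
    t.2 * ((lbase l).1 / (ldir l).1 - (lbase l).2 / (ldir l).2).
  by rewrite /lform; ring.
move=> /push_param_position [] [-> ->] /push_param_position [] [-> ->];
  [exists (u.1 - v.1, 0, 0) | exists (u.1, v.2, 1) |
   exists (- v.1, - u.2, - 1) | exists (0, v.2 - u.2, 0)];
  rewrite ?inE ?eqxx ?orbT // !E /push1 /push2 /=; split; ring.
Qed.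

Definition lcomb (c c' : R) (t t' : R * R * R) : R * R * R :=
  (c * t.1.1 + c' * t'.1.1, c * t.1.2 + c' * t'.1.2, c * t.2 + c' * t'.2).

Lemma lform_lcomb c c' t t' L :
  lform (lcomb c c' t t') L = c * lform t L + c' * lform t' L.
Proof. by rewrite /lform /=; ring. Qed.

(** The coefficients are the possible values of a sign divided by 1 or 2; the signs come from
    resolving the absolute values in (Q). *)
Definition comparison_forms (s : seq (R *p R)) : seq (R * R * R) :=
  let coefs := [:: 0; 1; - 1; 1 / 2; - 1 / 2] in
  let forms := [seq z | x <- s, z <- [seq t | y <- s, t <- push_forms x y]] in
  [seq z | c <- coefs, z <- [seq z' | c' <- coefs, z' <-
    [seq lcomb c c' t t' | t <- forms, t' <- forms]]].

Lemma mem_comparison_forms (s : seq (R *p R)) (c c' : R) t t' u v w x :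
  c \in [:: 0; 1; - 1; 1 / 2; - 1 / 2] -> c' \in [:: 0; 1; - 1; 1 / 2; - 1 / 2] ->
  u \in s -> v \in s -> w \in s -> x \in s ->
  t \in push_forms u v -> t' \in push_forms w x ->
  lcomb c c' t t' \in comparison_forms s.
Proof.
move=> cc cc' us vs ws xs tt tt'; apply: allpairs_f_dep cc _.
apply: allpairs_f_dep cc' _; apply: allpairs_f.
  by apply: allpairs_f_dep us _; apply: allpairs_f_dep vs _.
by apply: allpairs_f_dep ws _; apply: allpairs_f_dep xs _.
Qed.

(** The second clause is the conclusion of (Q). The first, without absolute values, says that the
    pushes come in the same order on both lines, as the bijections gamma require. *)
Definition same_comparisons (P : set (R *p R)) L L' :=
  forall u v w x, P u -> P v -> P w -> P x ->
  Num.sg (push_param L u - push_param L v) =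
  Num.sg (push_param L' u - push_param L' v) /\
  forall delta eta, delta \in [:: 1; 2]%N -> eta \in [:: 1; 2]%N ->
  Num.sg (`|push_param L u - push_param L v| / delta%:R
          - `|push_param L w - push_param L x| / eta%:R) =
  Num.sg (`|push_param L' u - push_param L' v| / delta%:R
          - `|push_param L' w - push_param L' x| / eta%:R).

Lemma push_comparisons (s : seq (R *p R)) L L' :
  (forall u, u \in s -> position L (Aff u) = position L' (Aff u)) ->
  (forall t, t \in comparison_forms s ->
     position L (switch_point t) = position L' (switch_point t)) ->
  same_comparisons [set` s] L L'.
Proof.
move=> pos_s pos_t u v w x /= us vs ws xs.
have [t tuv [e1 e1']] := push_param_sub (pos_s u us) (pos_s v vs).
have [t' twx [e2 e2']] := push_param_sub (pos_s w ws) (pos_s x xs).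
have sg_t y z r : y \in s -> z \in s -> r \in push_forms y z ->
    Num.sg (lform r L) = Num.sg (lform r L').
  move=> ys zs ryz.
  (* The coefficients 1 and 0 make every single difference one of the comparison forms. *)
  have er : lcomb 1 0 r r = r.
    by case: r {ryz} => -[a b] k; rewrite /lcomb /= !mul1r !mul0r !addr0.
  rewrite -er; apply: lform_sg; apply: pos_t.
  by apply: (mem_comparison_forms _ _ ys zs ys zs); rewrite // !inE eqxx ?orbT.
rewrite e1 e1' e2 e2'; split; first exact: sg_t us vs tuv.
move=> delta eta hd he.
(* Each absolute value is written as sign times value. The signs agree on [L] and [L'] by [sg_t], so
   one and the same form is evaluated on both lines. *)
have -> : `|lform t L| / delta%:R - `|lform t' L| / eta%:R =
    lform (lcomb (Num.sg (lform t L) / delta%:R)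
                 (- Num.sg (lform t' L) / eta%:R) t t') L.
  by rewrite lform_lcomb !normrEsg; ring.
have -> : `|lform t L'| / delta%:R - `|lform t' L'| / eta%:R =
    lform (lcomb (Num.sg (lform t L) / delta%:R)
                 (- Num.sg (lform t' L) / eta%:R) t t') L'.
  rewrite (sg_t _ _ _ us vs tuv) (sg_t _ _ _ ws xs twx).
  by rewrite lform_lcomb !normrEsg; ring.
apply: lform_sg; apply: pos_t; apply: (mem_comparison_forms _ _ us vs ws xs) => //.
  move: hd; rewrite !inE => /orP[] /eqP ->; case: sgrP => _;
    by rewrite ?divr1 ?mul0r ?eqxx ?orbT.
move: he; rewrite !inE => /orP[] /eqP ->; case: sgrP => _;
  by rewrite ?opprK ?oppr0 ?divr1 ?mul0r ?eqxx ?orbT.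
Qed.

Definition switch_points (s : seq (R *p R)) : set (ppoint R) :=
  [set switch_point t | t in [set` comparison_forms s]].

Lemma switch_set_switch_points s : switch_set (switch_points s).
Proof.
split; first exact/finite_image/finite_seq.
move=> v [t _]; rewrite /switch_point; case: ifP => // _; case: ifP => // t0 [<-].
by rewrite /= !normr_gt0; split; apply: contraTneq t0 => ->;
  rewrite ?mul0r ?mulr0 ltxx.
Qed.

Lemma line_equiv_comparisons (P : set (R *p R)) (s : seq (R *p R)) L L' :
  P = [set` s] -> line_equiv (@Aff R @` P `|` switch_points s) L L' ->
  same_comparisons P L L'.
Proof.
move=> -> eqL; apply: push_comparisons => [u us|t ts]; apply: eqL.
  by left; exists u.
by right; exists t.
Qed.
End SwitchPoints.

(** * Ranks under isomorphism and direct sum *)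

Section Ranks.
Context (F : fieldType) (d : Order.disp_t) (I : porderType d).
Implicit Types M N : pmodule F I.

Lemma limg_dim_bij (V W : vectType F) (f : 'Hom(V, W)) (U : {vspace V}) :
  injective f -> \dim (f @: U) = \dim U.
Proof.
by move=> /lker0P/eqP f0; apply: limg_dim_eq; rewrite f0 capv0.
Qed.

Lemma prank_iso M N u v : piso M N -> (u <= v)%O -> prank M u v = prank N u v.
Proof.
move=> [f [fbij fcomm]] uv; rewrite /prank.
rewrite -(limg_dim_bij _ (bij_inj (fbij v))) -limg_comp fcomm // limg_comp.
congr (\dim (_ @: _)); apply/eqP; rewrite eqEsubv subvf /=.
apply/subvP => y _; have [g _ fK] := fbij u.
by rewrite -[y]fK memv_img ?memvf.
Qed.

(** The image of [h] is the direct sum of the images of [f] and [g], embedded by the two coordinate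
    injections. *)
Lemma dim_limg_pair (V1 W1 V2 W2 : vectType F) (f : 'Hom(V1, W1))
    (g : 'Hom(V2, W2)) (h : 'Hom((V1 * V2)%type, (W1 * W2)%type)) :
  (forall x y, h (x, y) = (f x, g y)) ->
  \dim (limg h) = (\dim (limg f) + \dim (limg g))%N.
Proof.
move=> hE.
have inl_lin : linear (fun x : W1 => (x, 0 : W2)).
  by move=> a x y; congr pair; rewrite /= ?scaler0 ?addr0.
have inr_lin : linear (fun x : W2 => (0 : W1, x)).
  by move=> a x y; congr pair; rewrite /= ?scaler0 ?addr0.
pose il := GRing.isLinear.Build F W1 (W1 * W2)%type *:%R _ inl_lin.
pose ir := GRing.isLinear.Build F W2 (W1 * W2)%type *:%R _ inr_lin.
pose fl : {linear W1 -> (W1 * W2)%type} := HB.pack (fun x : W1 => (x, 0 : W2)) il.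
pose fr : {linear W2 -> (W1 * W2)%type} := HB.pack (fun x : W2 => (0 : W1, x)) ir.
have flE x : linfun fl x = (x, 0) by rewrite lfunE.
have frE x : linfun fr x = (0, x) by rewrite lfunE.
have -> : limg h = (linfun fl @: limg f + linfun fr @: limg g)%VS.
  apply/eqP; rewrite eqEsubv; apply/andP; split.
    apply/subvP => z /memv_imgP [[x y] _ ->]; apply/memv_addP.
    exists (f x, 0); first by rewrite -flE !memv_img ?memvf.
    exists (0, g y); first by rewrite -frE !memv_img ?memvf.
    by rewrite hE; congr pair; rewrite ?addr0 ?add0r.
  apply/subvP => z /memv_addP [_ /memv_imgP [x1 /memv_imgP [x _ ->] ->]].
  move=> [_ /memv_imgP [y1 /memv_imgP [y _ ->] ->] ->].
  have -> : linfun fl (f x) + linfun fr (g y) = h (x, y).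
    by rewrite flE frE hE; congr pair; rewrite /= ?addr0 ?add0r.
  by rewrite memv_img ?memvf.
have flI : injective (linfun fl) by move=> x y; rewrite !flE => -[].
have frI : injective (linfun fr) by move=> x y; rewrite !frE => -[].
rewrite dimv_disjoint_sum ?(limg_dim_bij _ flI) ?(limg_dim_bij _ frI) //.
apply/eqP; rewrite -subv0; apply/subvP => z; rewrite memv_cap memv0.
move=> /andP [/memv_imgP [x _ ->] /memv_imgP [y _]].
by rewrite flE frE => -[-> _].
Qed.

Lemma prank_dsum M N u v : prank (dsum M N) u v = (prank M u v + prank N u v)%N.
Proof. by apply: dim_limg_pair => x y; rewrite lfunE. Qed.

End Ranks.

(** * Ranks read off a barcode *)

Section Barcodes.
Context (F : fieldType) (R : realType).
Implicit Types (D : seq (R * \bar R)) (p : R * \bar R) (s t : R).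

Lemma dim_limg_const_mx (a b : bool) :
  \dim (limg (linfun (mulmxr (const_mx 1 : 'M[F]_(a, b))) :
    'Hom('rV[F]_a, 'rV[F]_b))) = (a && b).
Proof.
case: a b => -[] /=; last 3 first.
- apply/eqP; rewrite -leqn0; apply: leq_trans (dimvS (subvf _)) _.
  by rewrite dimvf /dim /= muln0.
- apply/eqP; rewrite -leqn0.
  (* The domain is zero here, so the bound comes from rank-nullity and not from the dimension of the
     codomain. *)
  set f := linfun _; have := limg_ker_dim f fullv; rewrite dimvf /dim /=.
  by move=> e; rewrite -[X in (_ <= X)%N]e leq_addl.
- apply/eqP; rewrite -leqn0; apply: leq_trans (dimvS (subvf _)) _.
  by rewrite dimvf /dim /= muln0.
set f := linfun _; apply/eqP; rewrite eqn_leq; apply/andP; split.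
  by apply: leq_trans (dimvS (subvf _)) _; rewrite dimvf /dim.
rewrite lt0n dimv_eq0; apply/eqP => f0.
have : f (const_mx 1) \in limg f by rewrite memv_img ?memvf.
rewrite f0 memv0 lfunE /= => /eqP /rowP /(_ ord0).
by rewrite !mxE big_ord1 !mxE mulr1 => /eqP; rewrite oner_eq0.
Qed.

Definition bar_rank D s t : nat :=
  count (fun p => (p.1 <= s) && (t%:E < p.2)%E) D.

Lemma prank_interval_sum D s t : s <= t ->
  prank (interval_sum F D) s t = bar_rank D s t.
Proof.
move=> st; elim: D => /= [|p D IH].
  apply/eqP; rewrite -leqn0; apply: leq_trans (dimvS (subvf _)) _.
  by rewrite dimvf /dim /= muln0.
rewrite prank_dsum IH /prank /= /interval_map dim_limg_const_mx /in_bar.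
congr (nat_of_bool _ + _)%N; case: (leP p.1 s) => //= ps.
rewrite (le_trans ps st) /=; case: (ltP t%:E p.2) => tp; rewrite ?andbF // andbT.
by rewrite (le_lt_trans _ tp) // lee_fin.
Qed.

Lemma dgm_rank (V : pmodule F R) D s t : is_dgm V D -> s <= t ->
  prank V s t = bar_rank D s t.
Proof. by move=> [_ VD] st; rewrite (prank_iso VD) // prank_interval_sum. Qed.
End Barcodes.

(** * Recovering a barcode from ranks that depend only on finitely many critical values *)

Section Levels.
Context (R : realType) (T : eqType).
Implicit Types (K : seq T) (f g : T -> R) (D E : seq (R * \bar R)).
Implicit Types (p q : R * \bar R).

(** Since [K] is finite, a level just below [x] separates [x] from all smaller values of [f]. It
    replaces the left limit at [x]. *)
Lemma exists_level_lt K f (x y : R) : y < x ->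
  exists s, [/\ y <= s, s < x & forall w, w \in K -> (f w <= s) = (f w < x)].
Proof.
move=> yx; elim: K => [|a K [s [ys sx sK]]]; first by exists y; rewrite yx lexx.
have [ax|xa] := ltP (f a) x; last first.
  exists s; split=> // w; rewrite inE => /orP[/eqP ->|/sK //].
  by rewrite leNgt (lt_le_trans sx xa) ltNge xa.
exists (Num.max s (f a)); split; rewrite ?le_max ?ys ?gt_max ?sx //.
move=> w; rewrite inE le_max => /orP[/eqP ->|/sK wK]; first by rewrite lexx orbT ax.
rewrite -wK; apply/orb_idr => wa; rewrite wK; exact: le_lt_trans ax.
Qed.

Lemma exists_upper_level K f (y : R) :
  exists2 t, y <= t & forall w, w \in K -> f w <= t.
Proof.
elim: K => [|a K [t yt tK]]; first by exists y.
exists (Num.max t (f a)); first by rewrite le_max yt.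
by move=> w; rewrite inE le_max => /orP[/eqP ->|/tK ->]; rewrite ?lexx ?orbT.
Qed.

Definition same_level K f g (s t : R) :=
  forall w, w \in K -> (f w <= s) = (g w <= t).

(** What (P) says about restrictions to two lines, with [f] and [g] in the role of the pushes onto
    them. *)
Definition same_ranks K f g D E := forall s t s' t', s <= t -> s' <= t' ->
  same_level K f g s s' -> same_level K f g t t' ->
  bar_rank D s t = bar_rank E s' t'.

Definition is_barcode D := forall p, p \in D -> (p.1%:E < p.2)%E.

Definition critical_bar K f p := exists2 u, u \in K & p.1 = f u /\
  (p.2 = +oo%E \/ exists2 v, v \in K & p.2 = (f v)%:E).

Lemma eq_count_sub (U : eqType) (a b : pred U) (s : seq U) :
  count a s = count b s -> subpred a b -> forall x, x \in s -> b x -> a x.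
Proof.
move=> /[swap] ab; elim: s => //= x s IH e.
have := ab x; have := sub_count ab s => le_s le_x.
have [ex es] : a x = b x /\ count a s = count b s.
  by case: (a x) (b x) le_x e le_s => -[] //= H; lia.
by move=> y; rewrite inE => /orP[/eqP -> | /(IH es) ]; rewrite ?ex.
Qed.

(** If a birth were not a value of [f], the ranks just before it and at it would agree, so every bar
    alive at it would already be alive before. The same argument excludes other finite deaths. *)
Lemma barcode_critical K f D : is_barcode D -> same_ranks K f f D D ->
  forall p, p \in D -> critical_bar K f p.
Proof.
move=> barD rD p pD; have p12 := barD p pD.
have lvl s : same_level K f f s s by [].
have lvl_lt x s : s < x -> (forall w, w \in K -> (f w <= s) = (f w < x)) ->
    (forall w, w \in K -> f w != x) -> same_level K f f s x.
  by move=> sx sK xK w wK; rewrite sK // lt_neqAle xK.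
have [u uK pu] : exists2 u, u \in K & p.1 = f u.
  apply: contrapT => nu.
  have [s [_ sx sK]] := @exists_level_lt K f p.1 (p.1 - 1) ltac:(lra).
  have e : bar_rank D s p.1 = bar_rank D p.1 p.1.
    apply: rD; rewrite ?lexx ?ltW //; apply: lvl_lt => // w wK.
    by apply/eqP => fw; apply: nu; exists w.
  suff /andP [] : (p.1 <= s) && (p.1%:E < p.2)%E by rewrite leNgt sx.
  apply: (eq_count_sub e) pD _; rewrite ?lexx // => q /andP [qs ->].
  by rewrite andbT (le_trans qs) ?ltW.
exists u => //; split=> //.
case ep : p.2 p12 => [x| |] // px; last by left.
right; apply: contrapT => nv; rewrite lte_fin in px.
(* The level stays at or above [p.1], so that ranks from [p.1] to [t] can be compared. *)
have [t [pt tx tK]] := @exists_level_lt K f x p.1 px.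
have e : bar_rank D p.1 x = bar_rank D p.1 t.
  apply/esym/rD; rewrite ?(ltW px) //; apply: lvl_lt => // w wK.
  by apply/eqP => fw; apply: nv; exists w; rewrite // fw.
suff /andP [_] : (p.1 <= p.1) && (x%:E < p.2)%E by rewrite ep ltxx.
apply: (eq_count_sub e) pD _; rewrite ?lexx ?ep ?lte_fin // => q /andP [-> qs].
by rewrite (lt_trans _ qs) ?lte_fin.
Qed.

Lemma eq_count_nat (U : eqType) (s : seq U) (a1 a2 b1 b2 b3 : pred U) :
  {in s, forall x, (a1 x + a2 x = b1 x + b2 x + b3 x)%N} ->
  (count a1 s + count a2 s = count b1 s + count b2 s + count b3 s)%N.
Proof.
elim: s => //= x s IH e.
have := e x (mem_head _ _); have := IH (fun y ys => e y (mem_behead (s := x :: s) ys)).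
lia.
Qed.

Lemma count_finite_bar K f D u v s t :
  (forall p, p \in D -> critical_bar K f p) ->
  s < f u -> (forall w, w \in K -> (f w <= s) = (f w < f u)) ->
  t < f v -> (forall w, w \in K -> (f w <= t) = (f w < f v)) ->
  (bar_rank D (f u) t + bar_rank D s (f v) =
   count_mem (f u, (f v)%:E) D + bar_rank D (f u) (f v) + bar_rank D s t)%N.
Proof.
move=> critD su sK tv tK; apply: eq_count_nat => -[b d] /critD /= [w wK /= [-> dE]].
rewrite sK // xpair_eqE.
have -> : (t%:E < d)%E = ((f v)%:E <= d)%E.
  case: dE => [->|[x xK ->]]; rewrite ?ltry ?leey //.
  by rewrite lte_fin lee_fin ltNge tK // -leNgt.
by case: (ltgtP (f w) (f u)); case: (ltgtP (f v)%:E d).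
Qed.

(** Past all critical values only infinite bars survive, so no correction at the death end
    arises. *)
Lemma count_infinite_bar K f D u s t :
  (forall p, p \in D -> critical_bar K f p) ->
  s < f u -> (forall w, w \in K -> (f w <= s) = (f w < f u)) ->
  (forall w, w \in K -> f w <= t) ->
  (bar_rank D (f u) t = count_mem (f u, +oo%E) D + bar_rank D s t)%N.
Proof.
move=> critD su sK tK; have := @eq_count_nat _ D
  (fun p => (p.1 <= f u) && (t%:E < p.2)%E) pred0 (pred1 (f u, +oo%E))
  (fun p => (p.1 <= s) && (t%:E < p.2)%E) pred0.
rewrite /bar_rank !count_pred0 !addn0 => -> // -[b d] /critD /= [w wK /= [-> dE]].
rewrite sK // xpair_eqE.
have -> : (t%:E < d)%E = (d == +oo%E).
  by case: dE => [->|[x xK ->]]; rewrite ?ltry ?eqxx // lte_fin ltNge tK.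
by case: (ltgtP (f w) (f u)); case: (d == +oo%E).
Qed.

(* Maps [f w] to [g w] for [w \in K]; the other values are junk. *)
Definition transfer K f g (x : R) : R := head x [seq g w | w <- K & f w == x].

Definition transfer_bar K f g p : R * \bar R :=
  (transfer K f g p.1, if p.2 is x%:E then (transfer K f g x)%:E else p.2).

(** * Transport of barcodes along an order-preserving correspondence of values *)

Section Transfer.
Context (K : seq T) (f g : T -> R).
Hypothesis fg : forall u w, u \in K -> w \in K -> (f u <= f w) = (g u <= g w).

(** [transfer] may pick another element with the same value of [f], but by [fg] it then has the same
    value of [g]. *)
Lemma transferE w : w \in K -> transfer K f g (f w) = g w.
Proof.
move=> wK; rewrite /transfer.
case e : [seq x <- K | f x == f w] => [|a s] /=.
  suff : w \in [seq x <- K | f x == f w] by rewrite e.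
  by rewrite mem_filter eqxx.
have : a \in [seq x <- K | f x == f w] by rewrite e mem_head.
rewrite mem_filter => /andP [/eqP fa aK].
by apply/eqP; rewrite eq_le -!fg // fa lexx.
Qed.

Lemma transfer_eq u w : u \in K -> w \in K -> (g u == g w) = (f u == f w).
Proof. by move=> uK wK; rewrite !eq_le !fg. Qed.

Lemma count_transfer D p : critical_bar K f p ->
  (forall q, q \in D -> critical_bar K f q) ->
  count_mem (transfer_bar K f g p) (map (transfer_bar K f g) D) = count_mem p D.
Proof.
move=> critp critD; rewrite count_map; apply: eq_in_count => q /critD.
case: p critp q => b d [u uK /= [-> dE]] [b' d'] [u' uK' /= [-> dE']].
rewrite /transfer_bar !xpair_eqE /= !transferE // transfer_eq //; congr (_ && _).
case: dE dE' => [->|[v vK ->]] [->|[v' vK' ->]] //=.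
by rewrite !transferE // !eqe transfer_eq.
Qed.

(** Multiplicities of corresponding bars are given by the same expression in ranks, and the ranks on
    the two sides agree at corresponding levels. *)
Lemma perm_transfer D E : is_barcode D -> is_barcode E ->
  same_ranks K f f D D -> same_ranks K g g E E -> same_ranks K f g D E ->
  perm_eq (map (transfer_bar K f g) D) E.
Proof.
move=> barD barE rD rE rDE.
have critD := barcode_critical barD rD; have critE := barcode_critical barE rE.
have fg_lt u w : u \in K -> w \in K -> (f u < f w) = (g u < g w).
  by move=> uK wK; rewrite !ltNge fg.
have main q : critical_bar K f q -> (q.1%:E < q.2)%E ->
    count_mem q D = count_mem (transfer_bar K f g q) E.
  case: q => _ d [u uK /= [-> dE]] ud.
  have [s [_ sf sfK]] := @exists_level_lt K f (f u) (f u - 1) ltac:(lra).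
  have [s' [_ sg sgK]] := @exists_level_lt K g (g u) (g u - 1) ltac:(lra).
  have ss' : same_level K f g s s' by move=> w wK; rewrite sfK // sgK // fg_lt.
  have uu : same_level K f g (f u) (g u) by move=> w wK; rewrite fg.
  case: dE ud => [->|[v vK ->]] ud; rewrite /transfer_bar /= !transferE //.
    have [t ut tK] := exists_upper_level K f (f u).
    have [t' ut' tK'] := exists_upper_level K g (g u).
    have tt' : same_level K f g t t' by move=> w wK; rewrite tK // tK'.
    have := count_infinite_bar critD sf sfK tK.
    have := count_infinite_bar critE sg sgK tK'.
    rewrite (rDE _ _ _ _ ut ut' uu tt').
    rewrite (rDE s t s' t') ?(le_trans (ltW sf) ut) ?(le_trans (ltW sg) ut') //.
    by move=> -> /addIn.
  rewrite lte_fin in ud; have ud' : g u < g v by rewrite -fg_lt.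
  have vv : same_level K f g (f v) (g v) by move=> w wK; rewrite fg.
  have [t [ut tf tfK]] := exists_level_lt K f ud.
  have [t' [ut' tg tgK]] := exists_level_lt K g ud'.
  have tt' : same_level K f g t t' by move=> w wK; rewrite tfK // tgK // fg_lt.
  have := count_finite_bar critD sf sfK tf tfK.
  have := count_finite_bar critE sg sgK tg tgK.
  rewrite (rDE _ _ _ _ ut ut' uu tt') (rDE _ _ _ _ (ltW ud) (ltW ud') uu vv).
  rewrite (rDE s t s' t') ?(le_trans (ltW sf) ut) ?(le_trans (ltW sg) ut') //.
  rewrite (rDE s (f v) s' (g v)) ?(ltW (lt_trans sf ud)) ?(ltW (lt_trans sg ud')) //.
  by move=> -> /addIn /addIn.
(* Multiplicities are compared only at bars that occur in one of the lists; each of these is the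
   transfer of a critical bar with birth before death. *)
apply/allP => q; rewrite mem_cat => qDE; apply/eqP.
suff [p [critp p12 <-]] : exists p,
    [/\ critical_bar K f p, (p.1%:E < p.2)%E & transfer_bar K f g p = q].
  by rewrite count_transfer // main.
case/orP: qDE => [/mapP [p pD ->]|qE].
  by exists p; split; [exact: critD | exact: barD |].
have := barE q qE; have := critE q qE.
case: q {qE} => _ d [u uK /= [-> [->|[v vK ->]]]] ud.
  by exists (f u, +oo%E); split; [exists u; [|split; [|left]] | exact: ltry |
    rewrite /transfer_bar /= transferE].
exists (f u, (f v)%:E); split; first by exists u => //; split => //; right; exists v.
  by move: ud; rewrite !lte_fin fg_lt.
by rewrite /transfer_bar /= !transferE.
Qed.
End Transfer.
End Levels.

(** A permutation of lists is realised by a list of indices, which gives the bijection of positions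
    needed to tell equal bars apart. *)
Lemma perm_eq_map_bij (T : eqType) (h : T -> T) (s t : seq T) :
  perm_eq (map h s) t ->
  exists2 g : 'I_(size s) -> 'I_(size t), bijective g &
    forall i, tnth (in_tuple t) (g i) = h (tnth (in_tuple s) i).
Proof.
move=> st; have size_st : size s = size t by rewrite -(perm_size st) size_map.
case: s st size_st => [|x0 s0].
  move=> _ /esym/size0nil ->; exists id; first by exists id.
  by case.
move: (_ :: _) => s st size_st; have /(perm_iotaP x0) [Is permIs sIs] := st.
have size_Is : size Is = size s by rewrite (perm_size permIs) size_iota size_st.
have ltIs (i : 'I_(size s)) : (nth 0 Is i < size t)%N.
  have : nth 0%N Is i \in iota 0 (size t).
    by rewrite -(perm_mem permIs) mem_nth // size_Is.
  by rewrite mem_iota.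
exists (fun i => Ordinal (ltIs i)).
  apply: inj_card_bij; last by rewrite !card_ord size_st.
  move=> i j /(congr1 val) /= /eqP; rewrite nth_uniq ?size_Is //; last first.
    by rewrite (perm_uniq permIs) iota_uniq.
  by move/eqP/val_inj.
move=> i; rewrite !(tnth_nth x0) /= -(nth_map x0 (h x0)) // sIs.
by rewrite (nth_map 0%N) ?size_Is.
Qed.

(** * Restrictions to lines and existence of the bijections gamma *)

Section Restrictions.
Context (R : realType) (F : fieldType).
Implicit Types (M N : pmodule F (R *p R)) (C : set (R *p R)) (L : line R).

(** By (P) a rank depends only on the critical values below its two points, and on a line these are
    the ones whose pushes lie below the given parameters. *)
Lemma restrict_same_ranks M C (K : seq (R *p R)) L L' D D' :
  property_P M C -> lub_closure C = [set` K] ->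
  is_dgm (Defs.restrict M L) D -> is_dgm (Defs.restrict M L') D' ->
  same_ranks K (push_param L) (push_param L') D D'.
Proof.
move=> [finC _ rankM] CK dgmD dgmD' s t s' t' st st' ss' tt'.
rewrite -(dgm_rank dgmD st) -(dgm_rank dgmD' st').
have belowE r r' : same_level K (push_param L) (push_param L') r r' ->
    below C (line_pt L r) = below C (line_pt L' r').
  move=> rr'; rewrite /below CK; apply/seteqP.
  by split=> w /= [wK wr]; split=> //; move: wr; rewrite !le_line_pt rr'.
have [r1 r0] := rankM _ _ (line_pt_le L st).
have [r1' r0'] := rankM _ _ (line_pt_le L' st').
rewrite -(belowE _ _ ss') -(belowE _ _ tt') in r1' r0'.
rewrite /prank /= -/(prank M _ _) -/(prank M _ _).
have [b0|b0] := eqVneq (below C (line_pt L s)) set0; first by rewrite r0 ?r0'.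
have {b0} b0 : below C (line_pt L s) !=set0 by apply/set0P.
have [u' maxu] := below_max finC b0.
(* The set of critical values below a point grows along the line, so the maximum at the later point
   exists too. *)
have b1 : below C (line_pt L t) !=set0.
  by case: b0 => w [Cw ws]; exists w; split; rewrite // (le_trans ws) ?line_pt_le.
have [v' maxv] := below_max finC b1.
by rewrite (r1 b0 _ _ maxu maxv) (r1' b0 _ _ maxu maxv).
Qed.

Lemma gamma_exists M C (K : seq (R *p R)) L L' D D' :
  property_P M C -> lub_closure C = [set` K] ->
  (forall u w, u \in K -> w \in K ->
    (push_param L u <= push_param L w) = (push_param L' u <= push_param L' w)) ->
  is_dgm (Defs.restrict M L) D -> is_dgm (Defs.restrict M L') D' ->
  exists gamma : 'I_(size D) -> 'I_(size D'), is_gamma C L L' gamma.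
Proof.
move=> PM CK LL' dgmD dgmD'.
have [g g_bij gE] := perm_eq_map_bij (perm_transfer LL' dgmD.1 dgmD'.1
  (restrict_same_ranks PM CK dgmD dgmD) (restrict_same_ranks PM CK dgmD' dgmD')
  (restrict_same_ranks PM CK dgmD dgmD')).
exists g; split=> // i; rewrite CK; split=> [u v /= uK vK|u /= uK] e;
  by rewrite [LHS]gE -/(dgm_pt i) e /transfer_bar /= !(transferE LL').
Qed.

End Restrictions.

(** * Corresponding costs on two lines and their comparison *)

Section Costs.
Context (R : realType) (P : set (R *p R)) (L L' : line R).
Hypothesis LL' : same_comparisons P L L'.

(** The values on [L] and on [L'] of one expression in pushes. It is a relation because several
    expressions may give the same [a]; [cost_match_fun] shows that [a'] is nevertheless
    determined. *)
Definition cost_match (a a' : \bar R) := (a = +oo%E /\ a' = +oo%E) \/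
  exists u v (delta : nat), [/\ P u, P v, delta \in [:: 1; 2]%N,
    a = (`|push_param L u - push_param L v| / delta%:R)%:E &
    a' = (`|push_param L' u - push_param L' v| / delta%:R)%:E].

Lemma push_distance_le u v w x (delta eta : nat) : P u -> P v -> P w -> P x ->
  delta \in [:: 1; 2]%N -> eta \in [:: 1; 2]%N ->
  (`|push_param L u - push_param L v| / delta%:R <=
   `|push_param L w - push_param L x| / eta%:R) =
  (`|push_param L' u - push_param L' v| / delta%:R <=
   `|push_param L' w - push_param L' x| / eta%:R).
Proof.
move=> Pu Pv Pw Px hd he; have [_ /(_ _ _ hd he)] := LL' Pu Pv Pw Px.
exact: eq_sg_sub_le.
Qed.

Lemma cost_match_le a a' b b' : cost_match a a' -> cost_match b b' ->
  (a <= b)%E = (a' <= b')%E.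
Proof.
move=> ma [[-> ->]|[w [x [et [Pw Px he -> ->]]]]]; first by rewrite !leey.
case: ma => [[-> ->]|[u [v [de [Pu Pv hd -> ->]]]]]; first by rewrite !leye_eq.
rewrite !lee_fin; exact: push_distance_le.
Qed.

Lemma cost_match_fun a a' b : cost_match a a' -> cost_match a b -> a' = b.
Proof.
move=> aa' ab; apply/eqP; rewrite eq_le.
by rewrite -(cost_match_le aa' ab) -(cost_match_le ab aa') lexx.
Qed.

Lemma cost_match_max a a' b b' : cost_match a a' -> cost_match b b' ->
  cost_match (maxe a b) (maxe a' b').
Proof.
move=> aa' bb'; have := cost_match_le aa' bb'.
case: (leP a b) => _ /esym; first by move=> /max_r ->.
by move=> /negbT; rewrite -ltNge => /ltW/max_l ->.
Qed.

Lemma cost_match_half u v : P u -> P v ->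
  cost_match (`|push_param L u - push_param L v| / 2)%:E
             (`|push_param L' u - push_param L' v| / 2)%:E.
Proof. by move=> Pu Pv; right; exists u, v, 2%N; split. Qed.

Lemma cost_match_dist u v : P u -> P v ->
  cost_match `|push_param L u - push_param L v|%:E
             `|push_param L' u - push_param L' v|%:E.
Proof.
by move=> Pu Pv; right; exists u, v, 1%N; split; rewrite ?divr1.
Qed.

Lemma bigmax_attained (I : finType) (Q : pred I) (f : I -> \bar R) (x : \bar R) :
  \big[maxe/x]_(i | Q i) f i = x \/
  exists2 i, Q i & \big[maxe/x]_(i | Q i) f i = f i.
Proof.
elim/big_rec : _ => [|i y Qi IH]; first by left.
by case: (leP (f i) y) => _; [exact: IH | right; exists i].
Qed.

(* Each maximum is attained, and the partners of the two maximizers bound each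
   other. *)
Lemma cost_match_bigmax (I J : finType) (Q : pred I) (Q' : pred J)
    (f : I -> \bar R) (g : J -> \bar R) : P !=set0 ->
  (forall i, Q i -> exists2 j, Q' j & cost_match (f i) (g j)) ->
  (forall j, Q' j -> exists2 i, Q i & cost_match (f i) (g j)) ->
  cost_match (\big[maxe/0%E]_(i | Q i) f i) (\big[maxe/0%E]_(j | Q' j) g j).
Proof.
move=> [u Pu] fg gf.
(* The default value 0 of the maxima is the distance from a push to itself, for which [P] must have
   a point. *)
have m0 : cost_match 0%E 0%E.
  by have := cost_match_dist Pu Pu; rewrite !subrr normr0.
set S := \big[_/_]_(i | Q i) _; set S' := \big[_/_]_(j | Q' j) _.
have [a' Sa' a'S'] : exists2 a', cost_match S a' & (a' <= S')%E.
  rewrite /S; have [->|[i Qi ->]] := bigmax_attained Q f 0%E.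
    by exists 0%E; rewrite // /S' bigmax_ge_id.
  by have [j Qj m] := fg i Qi; exists (g j); rewrite // /S' le_bigmax_cond.
have [b bS' bS] : exists2 b, cost_match b S' & (b <= S)%E.
  rewrite /S'; have [->|[j Qj ->]] := bigmax_attained Q' g 0%E.
    by exists 0%E; rewrite // /S bigmax_ge_id.
  by have [i Qi m] := gf j Qj; exists (f i); rewrite // /S le_bigmax_cond.
suff -> : S' = a' by [].
by apply/eqP; rewrite eq_le a'S' -(cost_match_le bS' Sa') bS.
Qed.

Definition bar_match (p p' : R * \bar R) := exists2 u, P u &
  [/\ p.1 = push_param L u, p'.1 = push_param L' u &
   (p.2 = +oo%E /\ p'.2 = +oo%E) \/ exists2 v, P v &
   p.2 = (push_param L v)%:E /\ p'.2 = (push_param L' v)%:E].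

Lemma ereal_dist_fin (x y : R) : ereal_dist x%:E y%:E = `|x - y|%:E.
Proof.
by rewrite /ereal_dist eqe; case: eqVneq => // ->; rewrite subrr normr0.
Qed.

Lemma linf_dist_match p p' q q' : bar_match p p' -> bar_match q q' ->
  cost_match (linf_dist p q) (linf_dist p' q').
Proof.
move=> [u Pu [pu pu' p2]] [w Pw [qw qw' q2]]; apply: cost_match_max.
  by rewrite pu pu' qw qw' !ereal_dist_fin; apply: cost_match_dist.
(* Two infinite deaths are at distance 0 by convention; one infinite and one finite death give an
   infinite cost on both lines. *)
case: p2 q2 => [[-> ->]|[v Pv [-> ->]]] [[-> ->]|[x Px [-> ->]]].
- rewrite /ereal_dist eqxx.
  by have := cost_match_dist Pu Pu; rewrite !subrr normr0.
- by left.
- by left.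
- by rewrite !ereal_dist_fin; apply: cost_match_dist.
Qed.

(** Birth precedes death on both lines, so a finite persistence is an absolute difference of pushes,
    with delta equal to 2. *)
Lemma half_persistence_match p p' : bar_match p p' ->
  (p.1%:E < p.2)%E -> (p'.1%:E < p'.2)%E ->
  cost_match (half_persistence p) (half_persistence p').
Proof.
case: p p' => b d [b' d'] [u Pu /= [-> ->]].
move=> [[-> ->] _ _|[v Pv [-> ->]]]; rewrite /half_persistence /=.
  by left; rewrite !addye // !gt0_mulye // lte_fin invr_gt0.
rewrite !lte_fin => uv uv'.
by have := cost_match_half Pv Pu; rewrite !gtr0_norm ?subr_gt0.
Qed.

End Costs.

(** * Transport of matchings by Gamma *)

Section Matchings.
Context (R : realType).
Implicit Types (D E : seq (R * \bar R)).

Lemma is_matchingP D E (sigma : {set 'I_(size D) * 'I_(size E)}) :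
  reflect (forall x y, x \in sigma -> y \in sigma ->
             (x.1 = y.1 -> x = y) /\ (x.2 = y.2 -> x = y))
          (is_matching sigma).
Proof.
apply: (iffP forall_inP) => [m x y xs ys|m x xs].
  have /forall_inP/(_ y ys)/andP [/implyP m1 /implyP m2] := m x xs.
  by split=> /eqP ?; apply/eqP; auto.
apply/forall_inP => y ys; have [m1 m2] := m x y xs ys.
by apply/andP; split; apply/implyP => /eqP ?; apply/eqP; auto.
Qed.

Lemma is_optimalP D E (sigma : {set 'I_(size D) * 'I_(size E)}) :
  is_optimal sigma <-> is_matching sigma /\
    forall tau : {set 'I_(size D) * 'I_(size E)},
      is_matching tau -> (cost sigma <= cost tau)%E.
Proof.
split=> -[m opt]; split=> //.
  by move=> tau mtau; rewrite opt; apply: bigmin_le_cond.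
apply/eqP; rewrite eq_le; apply/andP; split.
  by apply: le_bigmin => //; exact: leey.
exact: bigmin_le_cond.
Qed.

Context (DM DN DM' DN' : seq (R * \bar R)).
Context (gM : 'I_(size DM) -> 'I_(size DM')) (gN : 'I_(size DN) -> 'I_(size DN')).
Hypotheses (gM_bij : bijective gM) (gN_bij : bijective gN).
Implicit Types sigma : {set 'I_(size DM) * 'I_(size DN)}.

Let g x := (gM x.1, gN x.2).

Lemma Gamma_bij : bijective g.
Proof.
have [hM MK KM] := gM_bij; have [hN NK KN] := gN_bij.
by exists (fun x => (hM x.1, hN x.2)) => -[x y]; rewrite /g /= ?MK ?NK ?KM ?KN.
Qed.

Lemma Gamma_matching sigma : is_matching (Gamma gM gN sigma) = is_matching sigma.
Proof.
have gI := bij_inj Gamma_bij.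
apply/is_matchingP/is_matchingP => m.
  move=> x y xs ys; have := m (g x) (g y) (imset_f _ xs) (imset_f _ ys).
  by case=> m1 m2; split=> e; apply: gI; [apply: m1 | apply: m2]; rewrite /g /= e.
move=> _ _ /imsetP [x xs ->] /imsetP [y ys ->] /=.
have [m1 m2] := m x y xs ys.
by split=> [/(bij_inj gM_bij)/m1|/(bij_inj gN_bij)/m2] ->.
Qed.

Lemma Gamma_surj (tau : {set 'I_(size DM') * 'I_(size DN')}) :
  exists sigma, Gamma gM gN sigma = tau.
Proof.
have [h gK hK] := Gamma_bij; exists (h @: tau)%SET.
rewrite /Gamma -imset_comp -[RHS]imset_id; apply: eq_imset => x /=.
by rewrite -/g -[RHS]hK.
Qed.

Lemma Gamma_fst sigma i :
  (gM i \in (fst @: Gamma gM gN sigma)%SET) = (i \in (fst @: sigma)%SET).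
Proof.
rewrite -(mem_imset _ _ (bij_inj gM_bij)) /Gamma -!imset_comp.
by congr (_ \in _); apply: eq_imset.
Qed.

Lemma Gamma_snd sigma i :
  (gN i \in (snd @: Gamma gM gN sigma)%SET) = (i \in (snd @: sigma)%SET).
Proof.
rewrite -(mem_imset _ _ (bij_inj gN_bij)) /Gamma -!imset_comp.
by congr (_ \in _); apply: eq_imset.
Qed.

End Matchings.

(** * Cost and optimality of transported matchings *)

Section Optimality.
Context (R : realType) (P : set (R *p R)) (L L' : line R).
Hypothesis P0 : P !=set0.
Context (DM DN DM' DN' : seq (R * \bar R)).
Context (gM : 'I_(size DM) -> 'I_(size DM')) (gN : 'I_(size DN) -> 'I_(size DN')).
Hypotheses (gM_bij : bijective gM) (gN_bij : bijective gN).
Hypotheses (barM : is_barcode DM) (barN : is_barcode DN).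
Hypotheses (barM' : is_barcode DM') (barN' : is_barcode DN').
Hypothesis gM_match : forall i, bar_match P L L' (dgm_pt i) (dgm_pt (gM i)).
Hypothesis gN_match : forall i, bar_match P L L' (dgm_pt i) (dgm_pt (gN i)).
Hypothesis LL' : same_comparisons P L L'.

(** Gamma puts matched pairs and unmatched bars on the two lines in correspondence, and the terms of
    the three maxima match one by one. *)
Lemma cost_Gamma (sigma : {set 'I_(size DM) * 'I_(size DN)}) :
  cost_match P L L' (cost sigma) (cost (Gamma gM gN sigma)).
Proof.
apply: cost_match_max => //.
  apply: cost_match_bigmax => // [x xs|_ /imsetP [x xs ->]].
    exists (gM x.1, gN x.2); first exact: imset_f.
    exact: linf_dist_match.
  by exists x; last exact: linf_dist_match.
apply: cost_match_max => //; apply: cost_match_bigmax => // [i si|j].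
- exists (gM i); first by rewrite Gamma_fst.
  by apply: half_persistence_match => //; [apply: barM | apply: barM'];
    apply: mem_tnth.
- have [h _ hK] := gM_bij; rewrite -[j]hK Gamma_fst // => si.
  exists (h j) => //.
  by apply: half_persistence_match => //; [apply: barM | apply: barM'];
    apply: mem_tnth.
- exists (gN i); first by rewrite Gamma_snd.
  by apply: half_persistence_match => //; [apply: barN | apply: barN'];
    apply: mem_tnth.
- have [h _ hK] := gN_bij; rewrite -[j]hK Gamma_snd // => si.
  exists (h j) => //.
  by apply: half_persistence_match => //; [apply: barN | apply: barN'];
    apply: mem_tnth.
Qed.

(** Every competitor on [L'] is the image of a competitor on [L], and costs compare in the same way
    on both lines. *)
Lemma Gamma_optimal (sigma : {set 'I_(size DM) * 'I_(size DN)}) :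
  is_optimal sigma -> is_optimal (Gamma gM gN sigma).
Proof.
move=> /is_optimalP [ms opt]; apply/is_optimalP; rewrite Gamma_matching //.
split=> // tau'; have [tau <-] := Gamma_surj gM_bij gN_bij tau'.
rewrite Gamma_matching // => /opt.
by rewrite (cost_match_le LL' (cost_Gamma sigma) (cost_Gamma tau)).
Qed.

End Optimality.

(** * Arbitrary choices of gamma, and the assembly of (Q) and (Q') *)

Lemma gamma_match (R : realType) (F : fieldType) (M : pmodule F (R *p R))
    (C P : set (R *p R)) (K : seq (R *p R)) (L L' : line R) D D'
    (gamma : 'I_(size D) -> 'I_(size D')) :
  property_P M C -> lub_closure C = [set` K] -> lub_closure C `<=` P ->
  is_dgm (Defs.restrict M L) D -> is_gamma C L L' gamma ->
  forall i, bar_match P L L' (dgm_pt i) (dgm_pt (gamma i)).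
Proof.
move=> PM CK CP dgmD [_ gE] i.
(* [is_gamma] constrains only bars whose endpoints are pushes of critical values, or infinite; every
   bar of [D] is of this kind. *)
have [] := barcode_critical dgmD.1 (restrict_same_ranks PM CK dgmD dgmD)
  (mem_tnth i (in_tuple D)); rewrite -/(dgm_pt i).
move=> u uK; have Cu : lub_closure C u by rewrite CK.
have := gE i; case: (dgm_pt i) => b d [gfin ginf] /= [eb dE].
rewrite {b}eb in gfin ginf *; exists u; first exact: CP.
case: dE gfin ginf => [->|[v vK ->]] gfin ginf.
  by rewrite (ginf u Cu) //; split=> //; left.
have Cv : lub_closure C v by rewrite CK.
by rewrite (gfin u v Cu Cv) //; split=> //; right; exists v; first exact: CP.
Qed.

Theorem theorem4p4 (R : realType) (F : fieldType)
    (M N : pmodule F (R *p R)) (CM CN : set (R *p R))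
    (fpM : finitely_presented M) (fpN : finitely_presented N)
    (PM : property_P M CM) (PN : property_P N CN) :
  exists Omega : set (ppoint R),
    switch_set Omega /\
    property_Q CM CN Omega /\
    property_Q' M N CM CN Omega.
Proof.
have /finite_seqP [KM CMK] : finite_set (lub_closure CM).
  by apply: lub_closure_finite; case: PM.
have /finite_seqP [KN CNK] : finite_set (lub_closure CN).
  by apply: lub_closure_finite; case: PN.
have PK : critical_points CM CN = [set` KM ++ KN].
  rewrite /critical_points CMK CNK; apply/seteqP.
  by split=> w /=; rewrite mem_cat => /orP.
exists (switch_points (KM ++ KN)); split; first exact: switch_set_switch_points.
split=> [u v w x Pu Pv Pw Px delta eta hd he L L' LL'|].
  by have [_] := line_equiv_comparisons PK LL' Pu Pv Pw Px; apply.
move=> L DM DN dgmM dgmN sigma u v delta Pu Pv hd opt costE L' DM' DN' eqL dgmM' dgmN'.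
have comp := line_equiv_comparisons PK eqL.
have mono C : C `<=` critical_points CM CN -> forall x y, C x -> C y ->
    (push_param L x <= push_param L y) = (push_param L' x <= push_param L' y).
  move=> CP x y Cx Cy.
  have [e _] := comp x y x y (CP x Cx) (CP y Cy) (CP x Cx) (CP y Cy).
  exact: eq_sg_sub_le.
have subM : lub_closure CM `<=` critical_points CM CN by move=> x; left.
have subN : lub_closure CN `<=` critical_points CM CN by move=> x; right.
split; first by apply: (gamma_exists PM CMK _ dgmM dgmM') => x y xK yK;
  apply: (mono _ subM); rewrite CMK.
split; first by apply: (gamma_exists PN CNK _ dgmN dgmN') => x y xK yK;
  apply: (mono _ subN); rewrite CNK.
move=> gM gN gammaM gammaN.
have matchM := gamma_match PM CMK subM dgmM gammaM.
have matchN := gamma_match PN CNK subN dgmN gammaN.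
have P0 : critical_points CM CN !=set0 by exists u.
split.
  exact: (Gamma_optimal P0 gammaM.1 gammaN.1 dgmM.1 dgmN.1 dgmM'.1 dgmN'.1
    matchM matchN comp).
split=> _; last exact: costE.
(* Both sides correspond on [L'] to [cost sigma]: one as the cost of the transported matching, the
   other through [costE]. *)
apply: (cost_match_fun comp (a := cost sigma)).
  exact: (cost_Gamma P0 gammaM.1 gammaN.1 dgmM.1 dgmN.1 dgmM'.1 dgmN'.1
    matchM matchN comp).
by right; exists u, v, delta.
Qed.
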